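(* Let $p \geq q \geq d+1$ be integers and let $k$ be an integer with $0 \leq k \leq p-q-1$. Let $m_0(k)$ be the smallest integer $m$ such that $\binom{m+1}{2} \geq \frac{(p-q-k-1)(p-q+k+2)}{2}+1$. Let $\mathcal{F}$ be a finite family of at least $p$ compact convex sets in $\mathbb{R}^d$ which is non-$(p-q)$-degenerate and satisfies the $(p,q)_r$ property with \[ r \geq \binom{p}{q} - \binom{p-d+1}{q-d+1} + 1 + \binom{q-d-2+m_0(k)}{q-d} + \binom{q-d-1+m_0(k)}{q-d+1}. \] Then $\mathcal{F}$ can be pierced by at most $k+2$ points.
   Context: A family $\mathcal{F}$ with $|\mathcal{F}|\ge p$ satisfies the $(p,q)_r$ property if among any $p$ elements of $\mathcal{F}$, at least $r$ of the $q$-element subfamilies have non-empty common intersection. $\mathcal{F}$ is pierced by a set $S$ if every member of $\mathcal{F}$ meets $S$. $\mathcal{F}$ is $t$-degenerate if all elements of $\mathcal{F}$ except at most $t$ can be pierced by a single point; otherwise it is non-$t$-degenerate.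
   Formalization: The members of the family are assumed non-empty: an empty compact convex set can never be pierced, so the statement fails literally if the family contains the empty set. *)

(* Defs.v *)
From mathcomp Require Import all_boot all_order all_algebra finmap.
From mathcomp Require Import all_classical all_reals all_analysis.

Set Implicit Arguments.
Unset Strict Implicit.
Unset Printing Implicit Defensive.

Local Open Scope classical_set_scope.

(* A finite family of subsets of T is an indexed family F : I -> set T with
   I : finType, so repeated members are allowed.  Members are counted by index:
   the size of F is #|I|, and a subfamily is given by its index set in {set I}. *)

Definition intersecting (T : Type) (I : finType) (F : I -> set T)
    (J : {set I}) : Prop :=
  \bigcap_(i in [set` J]) F i !=set0.

Definition pq_r_property (T : Type) (I : finType) (F : I -> set T)
    (p q r : nat) : Prop :=
  (p <= #|I|)%N /\
  forall P : {set I}, #|P| = p ->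
    (r <= #|[set Q : {set I} |
              [&& Q \subset P, #|Q| == q & `[< intersecting F Q >]]]|)%N.

Definition pierced (T : Type) (I : finType) (F : I -> set T) (J : {set I})
    (S : set T) : Prop :=
  forall i, i \in J -> F i `&` S !=set0.

Definition degenerate (T : Type) (I : finType) (F : I -> set T) (t : nat) :
    Prop :=
  exists2 J : {set I}, (#|J| <= t)%N & exists x : T, pierced F (~: J) [set x].

(* For k < p - q all subtractions are exact, and so is the halving, since
   (p - q - k - 1) + (p - q + k + 2) is odd. *)
Definition m0_bound (p q k : nat) : nat :=
  ((p - q - k - 1) * (p - q + k + 2)) %/ 2 + 1.

Lemma m0_exists (p q k : nat) : exists m, (m0_bound p q k <= 'C(m.+1, 2))%N.
Proof.
exists (m0_bound p q k); rewrite /m0_bound addn1.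
by rewrite binS bin1 leq_addl.
Qed.

Definition m0 (p q k : nat) : nat := ex_minn (m0_exists p q k).

(* Main.v *)
(* Among the d-subfamilies with a common point, let G be the one whose
   intersection lies farthest from the origin, and let x be the nearest point
   of that intersection. By Helly's theorem for d+2 sets, a member of the family
   avoiding x never meets the intersection of G, and if the common part of two
   such members c, c' meets the intersection of G - g, it does so inside the
   ball |y| <= |x|, hence strictly below the hyperplane supporting that ball at
   x. Separating the members of G from this part of the ball yields d affine
   forms, nonnegative on the respective members of G and with negative sum on
   the cut ball. A convex set meeting the intersection of G - g there for every
   g must cross the line on which all these forms agree, by diagonal dominance
   of the matrix of values of the forms. Thus, if c and c' do not meet on this
   line, then (G - g) + c + c' has no common point for some g, and the members
   avoiding x behave like intervals: either k+1 points pierce them all, and k+2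
   points pierce the family, or k+2 of them are pairwise disjoint on the line.
   In the second case, p sets containing G, these k+2 members and at least
   p-q+1 members avoiding x (non-degeneracy) have too few intersecting
   q-subfamilies. *)

Require Import Defs.
From mathcomp Require Import all_boot all_order all_algebra finmap.
From mathcomp Require Import zify.

Set Implicit Arguments.
Unset Strict Implicit.
Unset Printing Implicit Defensive.

(** * Counting nonfaces *)

(** For [l > 0], ['C(a + l, a.+1) / l] equals ['C(a + l, a) / (a + 1)], which is nondecreasing in
    [l]. *)
Lemma bin_ratio (a l c : nat) :
  l <= c -> c * 'C(a + l, a.+1) <= l * 'C(a + c, a.+1).
Proof.
elim: c => [|c IHc]; first by rewrite leqn0 => /eqP ->.
rewrite leq_eqVlt => /predU1P[->//|]; rewrite ltnS => lc.
case: c => [|c] in IHc lc *.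
  by move: lc; rewrite leqn0 => /eqP ->; rewrite addn0 bin_small.
have binE : (a + c.+2) * 'C(a + c.+1, a.+1) = c.+1 * 'C(a + c.+2, a.+1).
  have := mul_bin_down (a + c.+2) a.+1.
  rewrite (_ : (a + c.+2).-1 = a + c.+1); last by lia.
  by rewrite (_ : a + c.+2 - a.+1 = c.+1); last by lia.
have {IHc}IH := IHc lc; rewrite -(@leq_pmul2l c.+1)//.
rewrite [leqRHS]mulnCA -binE; set x := 'C(_, _) in IH *.
set y := 'C(_, _) in IH *; nia.
Qed.

(** Sum [bin_ratio] over [c] from [l] to [m - 1] and use the hockey-stick identity. *)
Lemma bin_sum_ratio (a l m : nat) : l <= m ->
  'C(a + l, a.+1) * 'C(m, 2) + l * 'C(a + l, a.+2) <=
  l * 'C(a + m, a.+2) + 'C(a + l, a.+1) * 'C(l, 2).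
Proof.
elim: m => [|m IHm]; first by rewrite leqn0 => /eqP ->; rewrite muln0.
rewrite leq_eqVlt => /predU1P[->|]; first by rewrite addnC.
rewrite ltnS => lm; have := bin_ratio a lm; have := IHm lm.
rewrite addnS (binS m) (binS (a + m)) bin1; nia.
Qed.

(** For [l > 0], [bin_ratio] at [m - 1] and [bin_sum_ratio] show that the right side less
    ['C(a + l, a.+2)], times [l], is at least ['C(a + l, a.+1)] times [m - 1 + 'C(m, 2) - 'C(l, 2)].
    The [+ 1] in the hypothesis pays for [m - 1] in place of [m]. *)
Lemma m0_binomials (a l k m : nat) :
  k.+2 * l + 'C(l, 2) + 1 <= 'C(m.+1, 2) ->
  k.+2 * 'C(a + l, a.+1) + 'C(a + l, a.+2) <=
  'C(a + m - 1, a.+1) + 'C(a + m, a.+2).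
Proof.
case: l => [|l] hm.
   by rewrite addn0 (@bin_small a a.+1)// (@bin_small a a.+2)// muln0.
have lm : l.+1 < m.
  rewrite ltnNge; apply/negP => ml.
  have : 'C(m.+1, 2) <= 'C(l.+2, 2) by apply: leq_bin2l.
  by move: hm; rewrite (binS l.+1) bin1; nia.
case: m lm hm => // m; rewrite ltnS => lm hm.
have h1 := bin_sum_ratio a (leqW lm); have h2 := bin_ratio a lm.
rewrite (_ : a + m.+1 - 1 = a + m); last by lia.
rewrite -(@leq_pmul2l l.+1)//; move: hm h1 h2; rewrite (binS m.+1) bin1.
move: 'C(a + l.+1, a.+1) 'C(a + l.+1, a.+2) 'C(a + m, a.+1) 'C(a + m.+1, a.+2).
move: 'C(l.+1, 2) 'C(m.+1, 2) k.+2 => u v w x y x' y' hm h1 h2.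
have : x * (w * l.+1 + u) <= x * (v + m).
  by rewrite leq_mul2l; apply/orP; right; lia.
nia.
Qed.

Lemma subset_between (I : finType) (A B : {set I}) (n : nat) :
  A \subset B -> #|A| <= n <= #|B| ->
  exists C : {set I}, [/\ A \subset C, C \subset B & #|C| = n].
Proof.
move=> AB /andP[+ nB]; elim: n nB => [_|n IHn nB].
  by rewrite leqn0 => A0; exists A; rewrite (eqP A0).
rewrite leq_eqVlt => /predU1P[An|]; first by exists A.
rewrite ltnS => /(IHn (ltnW nB))[C [AC CB Cn]].
have [x xB xC] : exists2 x, x \in B & x \notin C.
  apply/subsetPn; apply: contraTN nB => /subset_leq_card.
  by rewrite Cn -ltnNge.
exists (x |: C); rewrite subUset sub1set xB CB cardsU1 xC Cn; split=> //.
exact: subset_trans AC (subsetUr _ _).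
Qed.

(** Such an [S] avoids [D], or is [x |: T] with [x] in [D] and [T] of size [s] in [B :\: D]. *)
Lemma card_draws_meet1 (I : finType) (B D : {set I}) (s : nat) :
  D \subset B ->
  #|[set S : {set I} | [&& S \subset B, #|S| == s.+1 & #|S :&: D| <= 1]]| <=
  'C(#|B| - #|D|, s.+1) + #|D| * 'C(#|B| - #|D|, s).
Proof.
move=> DB; have BD : #|B :\: D| = #|B| - #|D|.
  by rewrite cardsD (setIidPr DB).
pose W n := [set S : {set I} | S \subset B :\: D & #|S| == n].
have WE n : #|W n| = 'C(#|B| - #|D|, n) by rewrite /W cards_draws BD.
rewrite -!WE -cardsX.
apply: (@leq_trans #|W s.+1 :|: [set xT.1 |: xT.2 | xT in setX D (W s)]|).
  apply: subset_leq_card; apply/subsetP => S; rewrite !inE => /and3P[SB Ss].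
  rewrite leq_eqVlt ltnS leqn0 => /orP[/cards1P[x SDx]|]; last first.
    by rewrite cards_eq0 setI_eq0 subsetD SB Ss => ->.
  have /setIP[xS xD] : x \in S :&: D by rewrite SDx set11.
  apply/orP; right; apply/imsetP; exists (x, S :\ x); last by rewrite setD1K.
  rewrite !inE xD /= (eqP (_ : #|S :\ x| == s)); last first.
    by move: Ss; rewrite (cardsD1 x) xS.
  rewrite eqxx andbT subsetD (subset_trans (subsetDl _ _) SB)/=.
  rewrite -setI_eq0 -subset0; apply/subsetP => y; rewrite !inE.
  move=> /andP[/andP[yx yS] yD].
  have : y \in S :&: D by rewrite inE yS.
  by rewrite SDx inE (negPf yx).
by rewrite (leq_trans (leq_card_setU _ _))// leq_add2l leq_imset_card.
Qed.

(* With [s = q - #|G|], two disjoint kinds of nonfaces of size [q] are counted: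
   those containing [G], and the sets [(G :\ g) :|: S] with [S] in [B] of size
   [s.+1], at least two elements of [S] in [D] and [g] depending on [S]; the
   latter determine [S] as their trace on [B]. *)
Lemma nonfaces_bound (I : finType) (face : pred {set I}) (G B A D : {set I})
    (s : nat) :
  (forall Q Q' : {set I}, Q \subset Q' -> face Q' -> face Q) ->
  0 < #|G| -> [disjoint G & B] -> D \subset B -> #|B :\: A| < s ->
  (forall c, c \in A -> ~~ face (c |: G)) ->
  {in D &, forall c c', c != c' ->
    exists2 g, g \in G & ~~ face (c |: (c' |: G :\ g))} ->
  #|[set Q : {set I} | [&& Q \subset G :|: B, #|Q| == #|G| + s & face Q]]|
    + 'C(#|B|.+1, s.+1) <=
  'C(#|G| + #|B|, #|G| + s)
    + ('C(#|B| - #|D|, s.+1) + #|D| * 'C(#|B| - #|D|, s)).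
Proof.
move=> faceS G0 GB DB BAs AG DG.
pose P n := [set S : {set I} | (S \subset B) && (#|S| == n)].
have PE n : #|P n| = 'C(#|B|, n) by rewrite cards_draws.
pose S2 := [set S in P s.+1 | 1 < #|S :&: D|].
have S2E : 'C(#|B|, s.+1) <=
    #|S2| + ('C(#|B| - #|D|, s.+1) + #|D| * 'C(#|B| - #|D|, s)).
  rewrite -PE -(cardsID [set S : {set I} | 1 < #|S :&: D|]).
  apply: leq_add.
    by rewrite subset_leq_card//; apply/subsetP => S; rewrite !inE.
  apply: leq_trans (card_draws_meet1 s DB); apply: subset_leq_card.
  by apply/subsetP => S; rewrite !inE -leqNgt => /andP[-> /andP[-> ->]].
have [g0 g0G] : exists g, g \in G by apply/card_gt0P.
pose bad S g := (g \in G) && ~~ face ((G :\ g) :|: S).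
(* The default [g0] keeps [gap S] inside [G] when no element is bad. *)
pose gap S := odflt g0 [pick g | bad S g].
have gapG S : gap S \in G by rewrite /gap; case: pickP => // g /andP[].
have gapP S : S \in S2 -> ~~ face ((G :\ gap S) :|: S).
  rewrite !inE => /andP[_ /card_gt1P[c [c' [/setIP[cS cD] /setIP[c'S c'D] cc']]]].
  have [g gG gN] := DG c c' cD c'D cc'; rewrite /gap.
  case: pickP => [h /andP[]//|/(_ g)]; rewrite /bad gG /= => /negbFE.
  move=> fS; case/negP: gN; apply: faceS fS; apply/subsetP => x.
  by rewrite !inE => /or3P[/eqP->|/eqP->|->]; rewrite ?cS ?c'S ?orbT.
pose phi S := (G :\ gap S) :|: S.
have GBE x : x \in B -> (x \in G) = false.
  by move=> xB; apply/negbTE; move: GB; rewrite disjoint_sym => /disjointFr ->.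
have phiB S : S \in S2 -> phi S :&: B = S.
  rewrite !inE -andbA => /and3P[SB _ _]; apply/setP => x; rewrite !inE.
  have [xB|xB] := boolP (x \in B); first by rewrite GBE// andbF andbT.
  by rewrite andbF; apply/esym/negbTE; apply: contra xB; exact: subsetP.
pose U1 := [set G :|: S | S in P s].
pose U2 := [set phi S | S in S2].
have U1E : #|U1| = 'C(#|B|, s).
  rewrite card_in_imset ?PE// => S S'; rewrite !inE => /andP[SB _] /andP[S'B _].
  have capB (T : {set I}) : T \subset B -> (G :|: T) :&: B = T.
    by move=> TB; rewrite setIUl (disjoint_setI0 GB) set0U; exact/setIidPl.
  by move=> /(congr1 (fun X => X :&: B)); rewrite !capB.
have U2E : #|U2| = #|S2|.
  by rewrite card_in_imset// => S S' SS2 S'S2 E; rewrite -(phiB S)// E phiB.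
pose W := [set Q : {set I} | (Q \subset G :|: B) && (#|Q| == #|G| + s)].
have WE : #|W| = 'C(#|G| + #|B|, #|G| + s).
  by rewrite cards_draws cardsU (disjoint_setI0 GB) cards0 subn0.
pose X := [set Q : {set I} | [&& Q \subset G :|: B, #|Q| == #|G| + s & face Q]].
have XU1 : [disjoint X & U1].
  rewrite -setI_eq0 -subset0; apply/subsetP => Q; rewrite !inE.
  move=> /andP[/and3P[_ _ fQ] /imsetP[S]]; rewrite !inE => /andP[SB /eqP Ss QE].
  (* [S] has [s] elements, and fewer than [s] elements of [B] lie outside [A]. *)
  have [c cS cA] : exists2 c, c \in S & c \in A.
    apply/exists_inP; apply: contraLR BAs => /exists_inPn SA.
    rewrite -leqNgt -Ss subset_leq_card//; apply/subsetP => c cS.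
    by rewrite inE SA// (subsetP SB).
  case/negP: (AG c cA); apply: faceS fQ.
  by rewrite QE setUC setUS// sub1set.
have XU2 : [disjoint X & U2].
  rewrite -setI_eq0 -subset0; apply/subsetP => Q; rewrite !inE.
  move=> /andP[/and3P[_ _ fQ] /imsetP[S SS2 QE]].
  by case/negP: (gapP S SS2); rewrite -/(phi S) -QE.
have U12 : [disjoint U1 & U2].
  rewrite -setI_eq0 -subset0; apply/subsetP => Q; rewrite !inE.
  move=> /andP[/imsetP[S _ ->] /imsetP[S' S'S2 E]].
  have : gap S' \in G :|: S by rewrite inE gapG.
  rewrite E !inE eqxx /= => gS'; have := gapG S'.
  by rewrite GBE//; move: S'S2; rewrite !inE => /andP[/andP[/subsetP->]].
have U1W : U1 \subset W.
  apply/subsetP => _ /imsetP[S + ->]; rewrite !inE => /andP[SB /eqP Ss].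
  rewrite setUS//= cardsU Ss (_ : G :&: S = set0) ?cards0 ?subn0//.
  by apply/disjoint_setI0; apply: disjointWr GB.
have U2W : U2 \subset W.
  apply/subsetP => _ /imsetP[S SS2 ->]; have := SS2.
  rewrite !inE -andbA => /and3P[SB /eqP Ss _].
  rewrite setUSS ?subsetDl//= cardsU Ss (_ : _ :&: S = set0).
    rewrite cards0 subn0; have := cardsD1 (gap S) G; rewrite gapG.
    by rewrite add1n => ->; rewrite addSnnS.
  apply/disjoint_setI0; apply: disjointWr SB _.
  by apply: disjointWl GB; rewrite subsetDl.
have XW : X \subset W.
  by apply/subsetP => Q; rewrite !inE => /and3P[-> ->].
have : #|X :|: U1 :|: U2| <= #|W|.
  by rewrite subset_leq_card// !subUset XW U1W U2W.
rewrite cardsU (_ : (X :|: U1) :&: U2 = set0); last first.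
  by rewrite setIUl (disjoint_setI0 XU2) (disjoint_setI0 U12) setU0.
(* Pascal's rule splits ['C(#|B|.+1, s.+1)] into [#|U1|] and the number of all [S] of size
   [s.+1]. *)
rewrite cards0 subn0 cardsU (disjoint_setI0 XU1) cards0 subn0 U1E U2E WE -/X binS.
by move: S2E; lia.
Qed.

From mathcomp Require Import all_classical all_reals all_analysis.
From mathcomp Require Import ring lra.

Import Order.TTheory GRing.Theory Num.Theory.
Import numFieldNormedType.Exports.

Local Open Scope classical_set_scope.
Local Open Scope ring_scope.

(** * Convex combinations and Helly's theorem *)

Lemma convex_set_comb (R : numDomainType) (V : lmodType R) (A : set V) (x y : V)
    (t : R) : convex_set A -> A x -> A y -> 0 <= t -> t <= 1 ->
  A (t *: x + (1 - t) *: y).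
Proof.
move=> cA Ax Ay t0 t1; have := cA x y (Itv01 t0 t1).
by rewrite !inE; exact.
Qed.

Lemma convex_set_build (R : numDomainType) (V : lmodType R) (A : set V) :
  (forall x y (t : R), A x -> A y -> 0 <= t -> t <= 1 ->
    A (t *: x + (1 - t) *: y)) -> convex_set A.
Proof. by move=> cA x y t /set_mem Ax /set_mem Ay; rewrite inE; exact: cA. Qed.

Lemma convex_setI (R : numDomainType) (V : lmodType R) (A B : set V) :
  convex_set A -> convex_set B -> convex_set (A `&` B).
Proof.
move=> cA cB x y t; rewrite !inE => -[Ax Bx] [Ay By].
by split; apply: set_mem; [apply: cA|apply: cB]; apply: mem_set.
Qed.

Lemma convex_set_sum (R : numFieldType) (V : lmodType R) (A : set V)
    (J : eqType) (s : seq J) (P : pred J) (w : J -> R) (c : J -> V) :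
  convex_set A -> (forall j, P j -> 0 <= w j /\ A (c j)) ->
  0 < \sum_(j <- s | P j) w j ->
  A ((\sum_(j <- s | P j) w j)^-1 *: \sum_(j <- s | P j) w j *: c j).
Proof.
move=> cA wP; elim: s => [|j s IHs]; first by rewrite big_nil ltxx.
rewrite !big_cons; case: ifP => // Pj; have [wj Aj] := wP j Pj.
set W := \sum_(j <- s | P j) w j; set C := \sum_(j <- s | P j) _.
have W0 : 0 <= W by apply: sumr_ge0 => i /wP[].
move=> W'0; have [WE|Wn0] := eqVneq W 0.
  have wn0 : w j != 0 by move: W'0; rewrite WE addr0 => /lt0r_neq0.
  suff -> : C = 0 by rewrite WE !addr0 scalerA mulVf ?scale1r.
  have /eqP := WE; rewrite psumr_eq0; last by move=> i /wP[].
  move=> /allP wE; rewrite /C big_seq_cond big1// => i /andP[si Pi].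
  by have := wE i si; rewrite Pi => /eqP ->; rewrite scale0r.
have Wgt0 : 0 < W by rewrite lt0r Wn0.
have := convex_set_comb cA Aj (IHs Wgt0) (t := w j / (w j + W)).
have W'n0 := lt0r_neq0 W'0.
rewrite divr_ge0 ?(ltW W'0)// ler_pdivrMr// mul1r lerDl W0 => /(_ isT isT).
set x := (X in A X -> _); suff -> : (w j + W)^-1 *: (w j *: c j + C) = x by [].
rewrite scalerDr /x !scalerA; congr (_ *: _ + _ *: _); first exact: mulrC.
by rewrite -/W; field; rewrite Wn0.
Qed.

(* Radon's theorem in disguise: [#|J|] points in dimension [#|J| - 2] have an
   affine dependence, whose positive and negative parts give a common point. *)
Lemma helly_critical (R : realFieldType) (d : nat) (J : finType)
    (A : J -> set 'rV[R]_d) :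
  #|J| = d.+2 -> (forall j, convex_set (A j)) ->
  (forall j, exists p, forall i, i != j -> A i p) ->
  exists p, forall i, A i p.
Proof.
move=> J2 cA /choice[p pA].
pose e (i : 'I_#|J|) : J := enum_val i.
(* The column of ones turns a linear dependence of the rows into an affine dependence of the
   points. *)
pose M : 'M[R]_(#|J|, d + 1) := row_mx (\matrix_i p (e i)) (const_mx 1).
have [u u0 uM] : exists2 u : 'rV[R]_#|J|, u != 0 & u *m M = 0.
  have : kermx M != 0.
    rewrite -mxrank_eq0 -lt0n mxrank_ker subn_gt0.
    by rewrite (leq_ltn_trans (rank_leq_col _))// J2 addn1.
  by move=> /rowV0Pn[u /sub_kermxP uM u0]; exists u.
pose w j := u 0 (enum_rank j).
have [wp w0] : \sum_j w j *: p j = 0 /\ \sum_j w j = 0.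
  have sumE (V : zmodType) (f : J -> V) :
      \sum_j f j = \sum_i f (e i).
    by rewrite (reindex _ (onW_bij _ (@enum_val_bij J))).
  move: uM; rewrite mul_mx_row -row_mx0 => /eq_row_mx[uL uR]; split.
    rewrite sumE -[RHS]uL; apply/rowP => k; rewrite !mxE summxE.
    by apply: eq_bigr => i _; rewrite /w /e enum_valK !mxE.
  have := congr1 (fun A : 'rV__ => A 0 0) uR; rewrite !mxE => uR0.
  rewrite sumE -[RHS]uR0.
  by apply: eq_bigr => i _; rewrite /w /e enum_valK !mxE mulr1.
have w_split (V : zmodType) (f : J -> V) : \sum_j f j = 0 ->
    \sum_(j | 0 < w j) f j = - \sum_(j | ~~ (0 < w j)) f j.
  by rewrite (bigID (fun j => 0 < w j))/= => /eqP; rewrite addr_eq0 => /eqP.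
have wn0 : exists j, w j != 0.
  have /rV0Pn[k uk] := u0; exists (enum_val k).
  by rewrite /w enum_valK.
have Wpos : 0 < \sum_(j | 0 < w j) w j.
  rewrite lt0r sumr_ge0 ?andbT; last by move=> j /ltW.
  apply/eqP => W0; have [j wj] := wn0.
  have Wneg : \sum_(j | ~~ (0 < w j)) - w j = 0.
    by rewrite sumrN -(w_split _ w) ?w0.
  have [wj0|wj0] := ltP 0 (w j).
    have /eqP := W0; rewrite psumr_eq0; last by move=> i /ltW.
    by move=> /allP/(_ j (mem_index_enum _)); rewrite wj0/= (negPf wj).
  have /eqP := Wneg; rewrite psumr_eq0; last first.
    by move=> i; rewrite -leNgt oppr_ge0.
  move=> /allP/(_ j (mem_index_enum _)).
  by rewrite -leNgt wj0/= oppr_eq0 (negPf wj).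
exists ((\sum_(j | 0 < w j) w j)^-1 *: \sum_(j | 0 < w j) w j *: p j) => i.
(* [p j] lies in [A i] for [i != j], so the side of the dependence without [i] exhibits the point as
   an element of [A i]. *)
have [wi|wi] := ltP 0 (w i).
  have Eneg : \sum_(j | ~~ (0 < w j)) - w j = \sum_(j | 0 < w j) w j.
    by rewrite sumrN -(w_split _ w) ?w0.
  have -> : \sum_(j | 0 < w j) w j *: p j =
      \sum_(j | ~~ (0 < w j)) (- w j) *: p j.
    rewrite [RHS](eq_bigr (fun j => - (w j *: p j))); last first.
      by move=> j _; rewrite scaleNr.
    by rewrite sumrN (w_split _ _ wp).
  rewrite -Eneg; apply: convex_set_sum; rewrite ?Eneg// => j wj.
  split; first by rewrite oppr_ge0 leNgt.
  by apply: pA; apply: contraNneq wj => <-.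
apply: convex_set_sum => // j wj; split; first exact: ltW.
by apply: pA; apply: contraTneq wj => <-; rewrite -leNgt.
Qed.

(** * A line transversal to convex sets *)

(** A minimum principle: where [u] is minimal, the entry of [M *m u] is at least the row sum of [M]
    times that minimum, hence positive if the minimum is negative. *)
Lemma dominant_mulmx_ge0 (R : realFieldType) (n : nat) (M : 'M[R]_n)
    (u : 'cV[R]_n) :
  (forall l m, m != l -> 0 <= M l m) -> (forall l, \sum_m M l m < 0) ->
  (forall l, (M *m u) l 0 <= 0) -> forall l, 0 <= u l 0.
Proof.
move=> M0 Ms Mu l0.
have [l _ lmin] := arg_minP (fun l => u l 0) (isT : xpredT l0).
apply: (le_trans _ (lmin l0 isT)); rewrite leNgt; apply/negP => ul0.
have := Mu l; rewrite leNgt => /negP; apply.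
apply: (@lt_le_trans _ _ (\sum_m M l m * u l 0)).
  by rewrite -mulr_suml nmulr_rgt0.
rewrite mxE; apply: ler_sum => m _; have [->//|ml] := eqVneq m l.
by rewrite ler_wpM2l ?M0 ?lmin.
Qed.

(** Up to a change of sign [t <= 0], so the minimum principle makes [u] nonnegative, and its zero
    sum kills it. *)
Lemma dominant_mulmx_eq0 (R : realFieldType) (n : nat) (M : 'M[R]_n)
    (u : 'cV[R]_n) (t : R) :
  (forall l m, m != l -> 0 <= M l m) -> (forall l, \sum_m M l m < 0) ->
  M *m u = const_mx t -> \sum_l u l 0 = 0 -> u = 0.
Proof.
move=> M0 Ms; wlog t0 : u t / t <= 0 => [wl Mu us|Mu us].
  have [t0|/ltW t0] := leP t 0; first exact: (wl u t).
  apply/eqP; rewrite -oppr_eq0; apply/eqP; apply: (wl (- u) (- t)).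
  - by rewrite oppr_le0.
  - by rewrite mulmxN Mu; apply/matrixP => i j; rewrite !mxE.
  - by under eq_bigr do rewrite mxE; rewrite sumrN us oppr0.
have u0 : forall l, 0 <= u l 0.
  by apply: (dominant_mulmx_ge0 M0 Ms) => l; rewrite Mu mxE.
apply/colP => l; rewrite mxE; move/eqP: us; rewrite psumr_eq0//.
by move=> /allP/(_ l (mem_index_enum _))/eqP.
Qed.

Lemma dominant_unitmx (R : realFieldType) (n : nat) (M : 'M[R]_n) :
  (forall l m, m != l -> 0 <= M l m) -> (forall l, \sum_m M l m < 0) ->
  M \in unitmx.
Proof.
move=> M0 Ms; rewrite -unitmx_tr -row_free_unit -kermx_eq0.
apply/rowV0P => v /sub_kermxP vM.
have Mv : M *m v^T = 0 by rewrite -[M]trmxK -trmx_mul vM trmx0.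
have ge0 (w : 'cV[R]_n) : M *m w = 0 -> forall l, 0 <= w l 0.
  by move=> Mw; apply: (dominant_mulmx_ge0 M0 Ms) => l; rewrite Mw mxE.
apply/rowP => l; apply/eqP; rewrite mxE eq_le.
have := ge0 _ Mv l; rewrite mxE => ->; rewrite andbT -oppr_ge0.
by have := ge0 (- v^T); rewrite mulmxN Mv oppr0 => /(_ erefl l); rewrite !mxE.
Qed.

(** By the minimum principle [- invmx M] has nonnegative entries; [w] is the row of its column
    sums. *)
Lemma dominant_solution (R : realFieldType) (n : nat) (M : 'M[R]_n.+1) :
  (forall l m, m != l -> 0 <= M l m) -> (forall l, \sum_m M l m < 0) ->
  exists w : 'rV[R]_n.+1, [/\ forall l, 0 <= w 0 l, 0 < \sum_l w 0 l
    & w *m M = const_mx (-1)].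
Proof.
move=> M0 Ms; have Mu := dominant_unitmx M0 Ms.
pose w : 'rV[R]_n.+1 := const_mx (-1) *m invmx M.
have wM : w *m M = const_mx (-1) by rewrite /w mulmxKV.
have w0 l : 0 <= w 0 l.
  rewrite mxE sumr_ge0// => k _; rewrite mxE mulN1r.
  have -> : - invmx M k l = (- (invmx M *m delta_mx l 0)) k (0 : 'I_1).
    by rewrite -colE !mxE.
  apply: (dominant_mulmx_ge0 M0 Ms) => i.
  by rewrite mulmxN mulKVmx// !mxE oppr_le0; case: (_ && _).
exists w; split=> //; rewrite lt0r sumr_ge0// andbT psumr_eq0//.
apply/negP => /allP w_eq0; have /rowP/(_ 0) := wM.
rewrite !mxE big1 => [/eqP|l _]; first by rewrite eq_sym oppr_eq0 oner_eq0.
by rewrite (eqP (w_eq0 l (mem_index_enum _))) mul0r.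
Qed.

Lemma kermx_full_line (R : fieldType) (d : nat) (E : 'M[R]_(d + 1, d)) :
  row_full E -> exists b : 'rV[R]_(d + 1),
    forall w : 'rV_(d + 1), w *m E = 0 -> exists t, w = t *: b.
Proof.
move=> /eqP Er; have kr : \rank (kermx E) = 1 by rewrite mxrank_ker Er addKn.
exists (nz_row (kermx E)) => w /sub_kermxP wE; apply/sub_rVP.
apply: (submx_trans wE).
rewrite -(geq_leqif (mxrank_leqif_sup (nz_row_sub _))) kr lt0n mxrank_eq0.
by rewrite nz_row_eq0 -mxrank_eq0 kr.
Qed.

(* The points where all coordinates of [y *m N + beta] coincide, if there are
   any of the required kind, form a line. *)
Lemma common_transversal_line (R : realFieldType) (d : nat) (N : 'M[R]_d.+1)
    (beta : 'rV[R]_d.+1) :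
  exists a b : 'rV[R]_d.+1, forall Y : set 'rV[R]_d.+1, convex_set Y ->
    (forall l, exists c, [/\ Y c,
        forall m, m != l -> 0 <= (c *m N + beta) 0 m
      & \sum_m (c *m N + beta) 0 m < 0]) ->
  exists t, Y (a + t *: b).
Proof.
pose E : 'M[R]_(d.+1 + 1, d.+1) := col_mx N (const_mx (-1)).
have mulE (y : 'rV_d.+1) (t : R) : row_mx y t%:M *m E = y *m N - const_mx t.
  rewrite mul_row_col mul_scalar_mx; congr (_ + _).
  by apply/rowP => j; rewrite !mxE mulrN1.
(* If the columns of [E] are dependent, some [v != 0] has [N *m v^T = 0] and coordinate sum 0; then
   [M *m v^T] is constant and dominance forces [v = 0], so no such [Y] exists. *)
have [Efull|Enfull] := boolP (row_full E); last first.
  exists 0, 0 => Y cY /choice[c cP]; exfalso.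
  pose M : 'M[R]_d.+1 := \matrix_(l, m) (c l *m N + beta) 0 m.
  have M0 l m : m != l -> 0 <= M l m by rewrite mxE; have [_ + _] := cP l; apply.
  have Ms l : \sum_m M l m < 0.
    by under eq_bigr do rewrite mxE; have [] := cP l.
  have [v vE v0] : exists2 v : 'rV[R]_d.+1, E *m v^T = 0 & v != 0.
    have : kermx E^T != 0.
      by rewrite kermx_eq0 /row_free mxrank_tr.
    move=> /rowV0Pn[v /sub_kermxP vE v0]; exists v => //.
    by rewrite -[E]trmxK -trmx_mul vE trmx0.
  move: vE; rewrite mul_col_mx -col_mx0 => /eq_col_mx[Nv /colP/(_ 0)].
  rewrite !mxE => sv; case/eqP: v0; apply: trmx_inj; rewrite trmx0.
  apply: (@dominant_mulmx_eq0 _ _ M _ ((beta *m v^T) 0 0) M0 Ms).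
    have -> : M = (\matrix_l c l) *m N + const_mx 1 *m beta.
      apply/matrixP => l m; rewrite !mxE big_ord1 mxE mul1r; congr (_ + _).
      by apply: eq_bigr => i _; rewrite mxE.
    rewrite mulmxDl -mulmxA Nv mulmx0 add0r -mulmxA.
    by apply/colP => l; rewrite !mxE big_ord1 !mxE mul1r.
  apply/eqP; rewrite -oppr_eq0 -[X in _ == X]sv -sumrN; apply/eqP.
  by apply: eq_bigr => i _; rewrite [in RHS]mxE mulN1r.
have [b bP] := kermx_full_line Efull.
pose a := - beta *m pinvmx E.
have aE : a *m E = - beta by rewrite mulmxKpV// submx_full.
exists (lsubmx a), (lsubmx b) => Y cY /choice[c cP].
pose M : 'M[R]_d.+1 := \matrix_(l, m) (c l *m N + beta) 0 m.
have M0 l m : m != l -> 0 <= M l m by rewrite mxE; have [_ + _] := cP l; apply.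
have Ms l : \sum_m M l m < 0.
  by under eq_bigr do rewrite mxE; have [] := cP l.
have [w [w0 wpos wM]] := dominant_solution M0 Ms.
set W := \sum_l w 0 l in wpos.
pose y := W^-1 *: \sum_l w 0 l *: c l.
have Yy : Y y by apply: convex_set_sum => // l _; have [] := cP l.
have yN : y *m N + beta = const_mx (- W^-1).
  have MC : M = (\matrix_l c l) *m N + const_mx 1 *m beta.
    apply/matrixP => l m; rewrite !mxE big_ord1 mxE mul1r; congr (_ + _).
    by apply: eq_bigr => i _; rewrite mxE.
  have wC : w *m (\matrix_l c l) = \sum_l w 0 l *: c l.
    apply/rowP => j; rewrite !mxE summxE.
    by apply: eq_bigr => l _; rewrite !mxE.
  have w1 : w *m (const_mx 1 : 'cV_d.+1) = W%:M.
    apply/rowP => j; rewrite !ord1 !mxE mulr1n.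
    by apply: eq_bigr => l _; rewrite mxE mulr1.
  have := congr1 ( *:%R W^-1) wM.
  rewrite MC mulmxDr !mulmxA wC w1 mul_scalar_mx scalerDr scalerA.
  rewrite mulVf ?lt0r_neq0// scale1r scalemxAl => ->.
  by apply/rowP => j; rewrite !mxE mulrN1.
have [|t tP] := bP (row_mx y (- W^-1)%:M - a).
  by rewrite mulmxBl mulE aE -yN opprK opprD addrA subrr sub0r addNr.
exists t; suff -> : lsubmx a + t *: lsubmx b = y by [].
have : row_mx y (- W^-1)%:M = a + t *: b by rewrite -tP addrC subrK.
move=> /(congr1 lsubmx); rewrite row_mxKl => ->.
by apply/rowP => j; rewrite !mxE.
Qed.

(** * Separation of compact convex sets *)

Definition dot (R : realFieldType) (n : nat) (u v : 'rV[R]_n) : R :=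
  \sum_j u 0 j * v 0 j.

Section Dot.
Variables (R : realFieldType) (n : nat).
Implicit Types u v w : 'rV[R]_n.

Lemma dotC u v : dot u v = dot v u.
Proof. by apply: eq_bigr => j _; rewrite mulrC. Qed.

Lemma dotDl u v w : dot (u + v) w = dot u w + dot v w.
Proof.
by rewrite /dot -big_split/=; apply: eq_bigr => j _; rewrite mxE mulrDl.
Qed.

Lemma dotNl u v : dot (- u) v = - dot u v.
Proof. by rewrite /dot -sumrN; apply: eq_bigr => j _; rewrite mxE mulNr. Qed.

Lemma dotZl t u v : dot (t *: u) v = t * dot u v.
Proof. by rewrite /dot mulr_sumr; apply: eq_bigr => j _; rewrite mxE mulrA. Qed.

Lemma dotDr u v w : dot w (u + v) = dot w u + dot w v.
Proof. by rewrite dotC dotDl !(dotC w). Qed.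

Lemma dotNr u v : dot u (- v) = - dot u v.
Proof. by rewrite dotC dotNl dotC. Qed.

Lemma dotZr t u v : dot u (t *: v) = t * dot u v.
Proof. by rewrite dotC dotZl dotC. Qed.

Lemma dotr0 u : dot u 0 = 0.
Proof. by rewrite /dot big1// => j _; rewrite mxE mulr0. Qed.

Lemma dot_ge0 u : 0 <= dot u u.
Proof. by apply: sumr_ge0 => j _; rewrite -expr2 sqr_ge0. Qed.

Lemma dot_eq0 u : (dot u u == 0) = (u == 0).
Proof.
apply/eqP/eqP => [/eqP|->]; last first.
  by rewrite /dot big1// => j _; rewrite mxE mul0r.
rewrite psumr_eq0 => [/allP u0|j _]; last by rewrite -expr2 sqr_ge0.
apply/rowP => j; have := u0 j (mem_index_enum _).
by rewrite mulf_eq0 orbb mxE => /eqP.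
Qed.

Lemma coord_sqr_le u j : u 0 j ^+ 2 <= dot u u.
Proof.
rewrite /dot (bigD1 j)//= -expr2 lerDl sumr_ge0// => i _.
by rewrite -expr2 sqr_ge0.
Qed.

Definition dotE := (dotDl, dotDr, dotNl, dotNr, dotZl, dotZr).

End Dot.

Lemma slope_ge0 (R : realFieldType) (q s : R) : 0 <= s ->
  (forall t, 0 <= t -> t <= 1 -> 0 <= t * q *+ 2 + t ^+ 2 * s) -> 0 <= q.
Proof.
move=> s0 qs; rewrite leNgt; apply/negP => q0.
have sq0 : 0 < s - q by lra.
(* The denominator keeps [t] in []0, 1]] even if [s = 0], and gives
   [q *+ 2 + t * s = q * (1 + t)]. *)
pose t := - q / (s - q).
have t0 : 0 < t by rewrite divr_gt0// oppr_gt0.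
have tE : t * (s - q) = - q by rewrite divfK ?lt0r_neq0.
have t1 : t <= 1 by rewrite ler_pdivrMr// mul1r; lra.
have := qs t (ltW t0) t1.
rewrite (_ : _ + _ = t * (q *+ 2 + t * s)); last by ring.
rewrite pmulr_rge0// => h.
have : 0 <= t * (- q) by rewrite mulr_ge0 ?(ltW t0)//; lra.
by nra.
Qed.

(** Moving from [y] towards [x] stays in [A] and cannot decrease the distance to [z]; this is the
    first-order condition. *)
Lemma nearest_point_obtuse (R : realFieldType) (n : nat) (A : set 'rV[R]_n)
    (y z x : 'rV[R]_n) :
  convex_set A -> A y ->
  (forall x, A x -> dot (y - z) (y - z) <= dot (x - z) (x - z)) ->
  A x -> 0 <= dot (y - z) (x - y).
Proof.
move=> cA Ay ymin Ax; apply: (slope_ge0 (dot_ge0 (x - y))) => t t0 t1.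
have := ymin _ (convex_set_comb cA Ax Ay t0 t1); rewrite -subr_ge0.
move/le_trans; apply; rewrite le_eqVlt; apply/orP; left; apply/eqP.
by rewrite !dotE !(dotC x) !(dotC z) !(dotC y x); ring.
Qed.

Lemma dot_sqr_continuous (R : realType) (n : nat) (T : topologicalType)
  (f : T -> 'rV[R]_n) : continuous f -> continuous (fun x => dot (f x) (f x)).
Proof.
move=> cf; apply: continuous_big => [|j _ x]; first exact: add_continuous.
have cfj : {for x, continuous (fun x => f x 0 j)}.
  apply: (@continuous_comp _ _ _ f (fun v : 'rV[R]_n => v 0 j)); first exact: cf.
  exact: coord_continuous.
exact: continuousM.
Qed.

Lemma dot_continuous (R : realType) (n : nat) (u : 'rV[R]_n) :
  continuous (fun x => dot x u).
Proof.
apply: continuous_big => [|j _ x]; first exact: add_continuous.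
by apply: continuousM; [exact: coord_continuous|exact: cst_continuous].
Qed.

Lemma ball_halfspace_compact (R : realType) (n : nat) (u : 'rV[R]_n) (r s : R) :
  compact [set y | dot y y <= r /\ dot y u <= s].
Proof.
pose B : set 'rV[R]_n := 
  [set v | forall i, `[- (r + 1), r + 1]%classic (v ord0 i)].
have cB : compact B.
  by apply: (@rV_compact _ _ (fun=> `[- (r + 1), r + 1]%classic)) => _;
    exact: segment_compact.
apply: (subclosed_compact _ cB) => [|y [yr _] i]; last first.
  rewrite /= in_itv/=; have := le_trans (coord_sqr_le y i) yr.
  by rewrite expr2 => yi; apply/andP; split; nra.
rewrite (_ : mkset _ =
    (fun y => dot y y) @^-1` [set x | x <= r]
    `&` (fun y => dot y u) @^-1` [set x | x <= s])//.
apply: closedI; (apply: preimage_closed; last exact: closed_le) => x _.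
  by apply: dot_sqr_continuous => z; exact: cvg_id.
exact: dot_continuous.
Qed.

Lemma ball_halfspace_convex (R : realFieldType) (n : nat) (u : 'rV[R]_n) (r s : R) :
  convex_set [set y | dot y y <= r /\ dot y u <= s].
Proof.
apply: convex_set_build => x y t [xr xs] [yr ys] t0 t1.
split=> /=; last by rewrite !dotE; nra.
have t1' : 0 <= 1 - t by rewrite subr_ge0.
(* [t * |x|^2 + (1 - t) * |y|^2] exceeds the squared norm of the combination by
   [t * (1 - t) * |x - y|^2]. *)
have := mulr_ge0 (mulr_ge0 t0 t1') (dot_ge0 (x - y)).
have := ler_wpM2l t0 xr; have := ler_wpM2l t1' yr.
by rewrite !dotE !(dotC y x); lra.
Qed.

(* [N] and [beta] come from a closest configuration: they are the gaps
   [y_l - z] for points [y_l] of [A l] and [z] of [X] minimizing the sum of the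
   squared distances from [z] to the [y_l]. *)
Lemma strict_separation (R : realType) (n d : nat) (A : 'I_n -> set 'rV[R]_d)
    (X : set 'rV[R]_d) :
  (forall l, compact (A l)) -> (forall l, convex_set (A l)) ->
  (forall l, A l !=set0) -> compact X -> convex_set X ->
  (forall z, X z -> exists l, ~ A l z) ->
  exists (N : 'M[R]_(d, n)) (beta : 'rV[R]_n),
    (forall l y, A l y -> 0 <= (y *m N + beta) 0 l) /\
    (forall z, X z -> \sum_l (z *m N + beta) 0 l < 0).
Proof.
move=> cptA cA /choice[y0 Ay0] cptX cX AX.
have [X0|/set0P[z0 Xz0]] := eqVneq X set0.
  exists 0, 0; split=> [l y _|z]; last by rewrite X0.
  by rewrite mulmx0 addr0 mxE.
(* [None] indexes the point of [X] and [Some l] the point of [A l], so that configurations form a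
   compact product. *)
pose A' (i : option 'I_n) := if i is Some l then A l else X.
pose T := prod_topology (fun _ : option 'I_n => 'rV[R]_d : topologicalType).
pose K : set T := [set f | forall i, A' i (f i)].
have cptK : compact K by apply: tychonoff => -[l|]; [exact: cptA|exact: cptX].
have K0 : K !=set0.
  by exists (fun i => if i is Some l then y0 l else z0) => -[l|] /=.
pose Phi (f : T) := \sum_l dot (f (Some l) - f None) (f (Some l) - f None).
have cPhi : continuous Phi.
  apply: continuous_big => [|l _]; first exact: add_continuous.
  apply: (@dot_sqr_continuous _ _ _ (fun f : T => f (Some l) - f None)) => f.
  have cproj i : {for f, continuous (fun f : T => f i : 'rV[R]_d)}.
    exact: (@proj_continuous _ (fun _ => 'rV[R]_d : topologicalType) i f).
  by apply: continuousB; exact: cproj.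
have [f /set_mem Kf fmin] := compact_EVT_min K0 cptK (continuous_subspaceT cPhi).
pose g l := f (Some l) - f None.
(* Varying only [f (Some l)] shows it to be the point of [A l] nearest to [f None]. *)
have gA l y : A l y -> 0 <= dot (g l) (y - f (Some l)).
  apply: nearest_point_obtuse (cA l) (Kf (Some l)) _ => x Alx.
  pose f' : T := fun i => if i == Some l then x else f i.
  have /fmin : f' \in K.
    by rewrite inE => i; rewrite /f'; case: eqP => [->|_]; last exact: Kf.
  have f'l : f' (Some l) = x by rewrite /f' eqxx.
  rewrite /Phi (bigD1 l)//= [leRHS](bigD1 l)//= f'l [leRHS]addrC.
  rewrite (eq_bigr (fun m => dot (f' (Some m) - f None) (f' (Some m) - f None)));
    first by rewrite [leRHS]addrC lerD2r.
  by move=> m ml; rewrite /f'; case: eqP => // -[mE]; rewrite mE eqxx in ml.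
(* Vary only [f None], along the segment to [z]. *)
have gX z : X z -> \sum_l dot (g l) (z - f None) <= 0.
  move=> Xz; rewrite -oppr_ge0.
  apply: (@slope_ge0 _ _ (\sum_(l < n) dot (z - f None) (z - f None))).
    by apply: sumr_ge0 => l _; exact: dot_ge0.
  move=> t t0 t1; pose f' : T := fun i => if i is Some l then f i
                          else t *: z + (1 - t) *: f None.
  have /fmin : f' \in K.
    rewrite inE => -[l|] /=; first exact: (Kf (Some l)).
    exact: convex_set_comb cX Xz (Kf None) t0 t1.
  rewrite -subr_ge0 /Phi -sumrB => /le_trans; apply.
  rewrite -mulrnAl -sumrN mulr_sumr [X in _ + X]mulr_sumr -big_split/=.
  rewrite le_eqVlt; apply/orP; left; apply/eqP; apply: eq_bigr => l _; rewrite /f' /g /= !dotE.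
  rewrite (dotC z (f (Some l))) (dotC z (f None)) (dotC (f None) (f (Some l))).
  by ring.
exists (\matrix_(j, l) g l 0 j), (\row_l - dot (g l) (f (Some l))).
have formE y l : (y *m (\matrix_(j, l) g l 0 j) +
    \row_l - dot (g l) (f (Some l))) 0 l = dot (g l) (y - f (Some l)).
  rewrite !mxE dotDr dotNr (dotC (g l) y); congr (_ + _).
  by apply: eq_bigr => j _; rewrite mxE.
split=> [l y Aly|z Xz]; first by rewrite formE gA.
under eq_bigr do rewrite formE.
(* The squared gaps give strictness: if all vanished, [f None] would lie in [X] and in every
   [A l]. *)
rewrite (eq_bigr (fun l => dot (g l) (z - f None) - dot (g l) (g l))); last first.
  by move=> l _; rewrite -!(dotNr, dotDr); congr dot; rewrite /g opprB addrA subrK.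
rewrite sumrB subr_lt0; apply: (le_lt_trans (gX z Xz)).
rewrite lt0r sumr_ge0 ?andbT => [|l _]; last exact: dot_ge0.
apply/negP; rewrite psumr_eq0 => [/allP g0|l _]; last exact: dot_ge0.
have [l] := AX _ (Kf None); apply.
have /eqP := g0 l (mem_index_enum _); rewrite /= => /eqP.
by rewrite dot_eq0 subr_eq0 => /eqP <-; exact: Kf (Some l).
Qed.

(** * Reduction to intervals *)

(* Greedy choice: [M i] is the last of finitely many recorded points of the
   [i]-th interval, and the interval with the smallest [M i] is pierced there;
   recording only pairwise meeting points avoids any topology on the line. *)
Lemma interval_piercing (R : realDomainType) (V : choiceType) (I : finType)
    (F : I -> set V) (rho : R -> V) (m : nat) (J : {set I}) :
  (forall i, F i !=set0) ->
  (forall i s t x, F i (rho s) -> F i (rho t) -> s <= x -> x <= t ->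
    F i (rho x)) ->
  (exists D : {set I}, [/\ D \subset J, #|D| = m.+1 & {in D &, forall i j,
      i != j -> forall t, ~ (F i (rho t) /\ F j (rho t))}]) \/
  (exists s : seq V, (size s <= m)%N /\
    {in J, forall i, exists2 z, z \in s & F i z}).
Proof.
move=> F0 Fitv; elim: m J => [|m IHm] J.
  have [->|[i iJ]] := set_0Vmem J.
    by right; exists [::]; split=> // i; rewrite finset.in_set0.
  left; exists [set i]%SET; rewrite finset.sub1set cards1; split=> // j j'.
  by rewrite !finset.in_set1 => /eqP -> /eqP ->; rewrite eqxx.
have [->|[j0 j0J]] := set_0Vmem J.
  by right; exists [::]; split=> // i; rewrite finset.in_set0.
suff [i0 [J' [z [i0J i0J' J'J J'z J'i0]]]] : exists i0 (J' : {set I}) z,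
    [/\ i0 \in J, i0 \notin J', J' \subset J,
      {in J, forall i, i \notin J' -> F i z}
    & {in J', forall j t, ~ (F i0 (rho t) /\ F j (rho t))}].
  have [[D [DJ' Dm DF]]|[s [sm sF]]] := IHm J'; [left|right].
    have i0D : i0 \notin D by apply: contra i0J'; exact: (fintype.subsetP DJ').
    exists (i0 |: D)%SET; rewrite cardsU1 i0D Dm; split=> //.
      by rewrite finset.subUset finset.sub1set i0J (fintype.subset_trans DJ').
    move=> i j; rewrite !finset.in_setU1.
    move=> /predU1P[->|iD] /predU1P[->|jD]; rewrite ?eqxx// => ij t.
    - by apply: J'i0; exact: (fintype.subsetP DJ').
    - by move=> [? ?]; apply: (J'i0 i (fintype.subsetP DJ' _ iD) t).
    - exact: DF.
  exists (z :: s); split=> // i iJ; have [iJ'|iJ'] := boolP (i \in J').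
    by have [y ys Fy] := sF i iJ'; exists y; rewrite // inE ys orbT.
  by exists z; rewrite ?inE ?eqxx//; exact: J'z.
(* A member missing the line is disjoint there from all others; it is removed with a point of its
   own. *)
have [[i [iJ iN]]|allJ] :=
    pselect (exists i, i \in J /\ forall t, ~ F i (rho t)).
  have [z Fz] := F0 i; exists i, (J :\ i)%SET, z; split=> //.
  - by rewrite !inE eqxx.
  - exact: finset.subsetDl.
  - by move=> j jJ; rewrite !inE jJ andbT negbK => /eqP ->.
  - by move=> j _ t [/iN].
pose meet i j := `[< exists t, F i (rho t) /\ F j (rho t) >].
have meetJ i : i \in J -> meet i i.
  move=> iJ; apply/asboolP; apply: contrapT => iN; apply: allJ; exists i.
  by split=> // t Ft; apply: iN; exists t.
have [w wP] : exists w : I * I -> R, forall ij, meet ij.1 ij.2 ->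
    F ij.1 (rho (w ij)) /\ F ij.2 (rho (w ij)).
  suff /choice[w wP] : forall ij : I * I, exists t, meet ij.1 ij.2 ->
    F ij.1 (rho t) /\ F ij.2 (rho t) by exists w.
  move=> ij; have [/asboolP[t tP]|] := boolP (meet ij.1 ij.2).
    by exists t => _.
  by exists 0.
have [M MP] : exists M : I -> R, forall i, i \in J -> F i (rho (M i)) /\
    forall j, meet i j -> w (i, j) <= M i.
  suff /choice[M MP] : forall i, exists x, i \in J -> F i (rho x) /\
    forall j, meet i j -> w (i, j) <= x by exists M.
  move=> i; have [iJ|] := boolP (i \in J); last by exists 0.
  have [j ij jmax] := arg_maxP (fun j => w (i, j)) (meetJ i iJ).
  by exists (w (i, j)) => _; split; [have [] := wP (i, j) ij|exact: jmax].
have [i0 /= i0J' i0min] := arg_minP M j0J.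
have i0J : i0 \in J by [].
exists i0, [set j in J | `[< ~ F j (rho (M i0)) >]]%SET, (rho (M i0)); split=> //.
- by rewrite inE i0J /=; apply/asboolPn; rewrite not_notP; have [] := MP i0 i0J.
- by apply/fintype.subsetP => j; rewrite inE => /andP[].
- by move=> j jJ; rewrite inE jJ/= => /asboolPn; rewrite not_notP.
move=> j; rewrite inE => /andP[jJ /asboolP jN] t i0jt; apply: jN.
have i0j : meet i0 j by apply/asboolP; exists t.
(* [F j] contains the points at [w (i0, j) <= M i0] and at [M j >= M i0], hence the one at
   [M i0]. *)
have [_ Fw] := wP (i0, j) i0j; have [Fj _] := MP j jJ.
by apply: Fitv Fw Fj _ (i0min j jJ); have [_ ->] := MP i0 i0J.
Qed.

Lemma intersectingP (T : Type) (I : finType) (F : I -> set T) (J : {set I}) :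
  intersecting F J <-> exists x, forall i, i \in J -> F i x.
Proof. by split=> -[x xP]; exists x => i iJ; exact: xP. Qed.

Lemma intersectingS (T : Type) (I : finType) (F : I -> set T) (J K : {set I}) :
  J \subset K -> intersecting F K -> intersecting F J.
Proof.
move=> /fintype.subsetP JK /intersectingP[x xK]; apply/intersectingP.
by exists x => i /JK; exact: xK.
Qed.

Lemma nearest_in_intersection (R : realType) (d : nat) (I : finType)
    (F : I -> set 'rV[R]_d) (J : {set I}) :
  (forall i, compact (F i)) -> (0 < #|J|)%N -> intersecting F J ->
  exists p, (forall i, i \in J -> F i p) /\
    forall y, (forall i, i \in J -> F i y) -> dot p p <= dot y y.
Proof.
move=> cptF /card_gt0P[i0 i0J] J0.
have cptJ : compact (\bigcap_(i in [set` J]) F i).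
  rewrite (_ : bigcap _ _ = F i0 `&` \bigcap_(i in [set` J]) F i).
    apply: compact_closedI => //; apply: closed_bigI => i _.
    by apply: compact_closed; [exact: norm_hausdorff|exact: cptF].
  by apply/seteqP; split=> [x xJ|x []//]; split=> //; exact: xJ.
have cdot : continuous (fun y : 'rV[R]_d => dot y y).
  by apply: dot_sqr_continuous => y; exact: cvg_id.
have [p /set_mem Jp pmin] := compact_EVT_min J0 cptJ (continuous_subspaceT cdot).
by exists p; split=> [i iJ|y yJ]; [exact: Jp|apply: pmin; rewrite inE].
Qed.

(** This is [helly_critical] for the members of [E] and, at index [None], the ball. *)
Lemma helly_ball (R : realFieldType) (d : nat) (I : finType)
    (F : I -> set 'rV[R]_d) (E : {set I}) (r : R) :
  (forall i, convex_set (F i)) -> #|E| = d.+1 -> intersecting F E ->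
  (forall e, e \in E -> exists y, dot y y <= r /\
    forall i, i \in (E :\ e)%SET -> F i y) ->
  exists y, dot y y <= r /\ forall i, i \in E -> F i y.
Proof.
move=> cF Ed /intersectingP[z Ez] EF.
pose J := option {i | i \in E}.
pose A (j : J) : set 'rV[R]_d := if j is Some e then F (val e) else
  [set y | dot y y <= r /\ dot y 0 <= 0].
have [| | |y yA] := @helly_critical _ _ J A.
- by rewrite card_option card_sig Ed.
- by case=> [e|] /=; [exact: cF|exact: ball_halfspace_convex].
- case=> [[e eE]|] /=; last first.
    by exists z => -[[i iE] _|]; [exact: Ez|rewrite eqxx].
  have [y [yr yE]] := EF e eE; exists y => -[[i iE] ie|_] /=.
    by apply: yE; rewrite !inE iE andbT; apply: contra ie => /eqP ie; apply/eqP;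
      congr Some; exact: val_inj.
  by rewrite dotr0.
exists y; split=> [|i iE]; first by have [] := yA None.
exact: yA (Some (exist _ i iE)).
Qed.

(* [G] is the [d.+1]-subset whose intersection is farthest from the origin and
   [x] is the point of that intersection nearest to the origin. *)
Lemma line_reduction (R : realType) (d : nat) (I : finType)
    (F : I -> set 'rV[R]_d.+1) (G0 : {set I}) :
  (forall i, compact (F i)) -> (forall i, convex_set (F i)) ->
  #|G0| = d.+1 -> intersecting F G0 ->
  exists (G : {set I}) (x a b : 'rV[R]_d.+1),
    [/\ #|G| = d.+1, forall g, g \in G -> F g x,
        forall c, ~ F c x -> ~ intersecting F (c |: G)%SET
      & forall c c', c != c' -> ~ F c x -> ~ F c' x ->
          (forall g, g \in G -> intersecting F (c |: (c' |: G :\ g))%SET) ->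
          exists t, F c (a + t *: b) /\ F c' (a + t *: b)].
Proof.
move=> cptF cF G0d G0int.
have [v vP] : exists v : {set I} -> 'rV[R]_d.+1, forall J : {set I},
    (0 < #|J|)%N -> intersecting F J -> (forall i, i \in J -> F i (v J)) /\
    forall y, (forall i, i \in J -> F i y) -> dot (v J) (v J) <= dot y y.
  suff /choice[v vP] : forall J : {set I}, exists p : 'rV[R]_d.+1,
    (0 < #|J|)%N -> intersecting F J -> (forall i, i \in J -> F i p) /\
    forall y, (forall i, i \in J -> F i y) -> dot p p <= dot y y by exists v.
  move=> J; have [[J0 Jint]|NJ] := pselect ((0 < #|J|)%N /\ intersecting F J).
    by have [p pP] := nearest_in_intersection cptF J0 Jint; exists p.
  by exists 0 => J0 Jint; case: NJ.
pose cand (J : {set I}) := (#|J| == d.+1) && `[< intersecting F J >].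
have candG0 : cand G0 by rewrite /cand G0d eqxx; apply/asboolP.
have [G /andP[/eqP Gd /asboolP Gint] Gmax] :=
  arg_maxP (fun J => dot (v J) (v J)) candG0.
set x := v G in Gmax.
have [Gx xmin] : (forall i, i \in G -> F i x) /\
    forall y, (forall i, i \in G -> F i y) -> dot x x <= dot y y.
  by apply: vP => //; rewrite Gd.
have obtuse y : (forall i, i \in G -> F i y) -> dot x x <= dot y x.
  move=> Gy; have := @nearest_point_obtuse _ _ (\bigcap_(i in [set` G]) F i) x 0 y.
  rewrite !subr0 dotDr dotNr subr_ge0 (dotC x y); apply=> //.
  - apply: convex_set_build => u w t Fu Fw t0 t1 i iG.
    exact: convex_set_comb (cF i) (Fu i iG) (Fw i iG) t0 t1.
  - by move=> u Fu; rewrite !subr0; apply: xmin => i iG; exact: Fu.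
(* Each [E :\ e] competes with [G], so by maximality its nearest point is no farther from the origin
   than [x]. *)
have ball (E : {set I}) : #|E| = d.+2 -> intersecting F E ->
    exists y, dot y y <= dot x x /\ forall i, i \in E -> F i y.
  move=> Ed Eint; apply: helly_ball => // e eE.
  have Eed : #|(E :\ e)%SET| = d.+1.
    by have := cardsD1 e E; rewrite eE Ed add1n => -[].
  have Eeint : intersecting F (E :\ e)%SET.
    exact: intersectingS (finset.subsetDl _ _) Eint.
  exists (v (E :\ e)%SET); split; last by have [] := vP (E :\ e)%SET; rewrite ?Eed.
  by apply: Gmax; rewrite /cand Eed eqxx; apply/asboolP.
have below y : dot y y <= dot x x -> y != x -> dot y x < dot x x.
  move=> yx; rewrite -subr_eq0 -dot_eq0 => yx0.
  have : 0 < dot (y - x) (y - x) by rewrite lt0r yx0 dot_ge0.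
  by rewrite !dotE (dotC x y); lra.
have notG c : ~ F c x -> c \notin G by move=> cx; apply/negP => /Gx.
suff [a [b abP]] : exists a b : 'rV[R]_d.+1,
    forall c c', c != c' -> ~ F c x -> ~ F c' x ->
      (forall g, g \in G -> intersecting F (c |: (c' |: G :\ g))%SET) ->
      exists t, F c (a + t *: b) /\ F c' (a + t *: b).
  exists G, x, a, b; split=> // c cx cGint.
  have [|y [yx yE]] := ball _ _ cGint; first by rewrite cardsU1 notG ?Gd.
  have yG i : i \in G -> F i y by move=> iG; apply: yE; rewrite !inE iG orbT.
  have [E|/(below _ yx)] := eqVneq y x.
    by apply: cx; rewrite -E; apply: yE; rewrite !inE eqxx.
  by rewrite ltNge obtuse.
(* Every intersection of two members of the family avoiding [x] with all but
   one member of [G] has a point in the ball strictly below the supporting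
   hyperplane at [x]; finitely many such points stay below some level [s]. *)
pose tri (t : I * I * I) := (t.1.1 |: (t.1.2 |: G :\ t.2))%SET.
pose ok (t : I * I * I) := [&& t.1.1 != t.1.2, t.2 \in G,
  `[< ~ F t.1.1 x >], `[< ~ F t.1.2 x >] & `[< intersecting F (tri t) >]].
have [z zP] : exists z : I * I * I -> 'rV[R]_d.+1, forall t, ok t ->
    [/\ forall i, i \in tri t -> F i (z t), dot (z t) (z t) <= dot x x
      & dot (z t) x < dot x x].
  suff /choice[z zP] : forall t, exists y, ok t ->
    [/\ forall i, i \in tri t -> F i y, dot y y <= dot x x
      & dot y x < dot x x] by exists z.
  move=> t; have [|_] := boolP (ok t); last by exists 0.
  move=> /and5P[cc' gG /asboolP cx /asboolP c'x /asboolP tint].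
  have [|y [yx yE]] := ball _ _ tint.
    have Gg : #|(G :\ t.2)%SET| = d.
      by have := cardsD1 t.2 G; rewrite gG Gd add1n => -[].
    rewrite /tri !cardsU1 !inE (negPf cc') (negPf (notG _ cx)).
    by rewrite (negPf (notG _ c'x)) !andbF Gg.
  exists y => _; split=> //; apply: below => //; apply/eqP => yE'.
  by apply: cx; rewrite -yE'; apply: yE; rewrite !inE eqxx.
(* The default keeps [s] strictly below [dot x x] when no triple is [ok]. *)
pose s := \big[Num.max/dot x x - 1]_(t | ok t) dot (z t) x.
have sx : s < dot x x.
  by apply/bigmax_ltP; split=> [|t /zP[]//]; rewrite ltrBlDr ltrDl.
have sz t : ok t -> dot (z t) x <= s by move=> okt; exact: le_bigmax_cond.
pose X : set 'rV[R]_d.+1 := [set y | dot y y <= dot x x /\ dot y x <= s].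
pose gs (l : 'I_d.+1) : I := enum_val (cast_ord (esym Gd) l).
have gsG l : gs l \in G by exact: enum_valP.
have gsK i : i \in G -> exists l, gs l = i.
  move=> iG; exists (cast_ord Gd (enum_rank_in iG i)).
  by rewrite /gs cast_ordK enum_rankK_in.
have gs_inj : injective gs by move=> l m /enum_val_inj/cast_ord_inj.
have [||||||N [beta [Nge0 Nlt0]]] :=
    @strict_separation R d.+1 d.+1 (fun l => F (gs l)) X.
- by move=> l; exact: cptF.
- by move=> l; exact: cF.
- by move=> l; exists x; exact: Gx.
- exact: ball_halfspace_compact.
- exact: ball_halfspace_convex.
(* A point of [X] common to all members of [G] would violate [obtuse]. *)
- move=> y [_ ys]; apply: contrapT => /forallNP yA.
  have /obtuse : forall i, i \in G -> F i y.
    by move=> i /gsK[l <-]; apply: contrapT; exact: yA.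
  by rewrite leNgt (le_lt_trans ys sx).
have [a [b abP]] := common_transversal_line N beta.
exists a, b => c c' cc' cx c'x cc'int.
have okl l : ok (c, c', gs l).
  apply/and5P; split; rewrite //=; try exact/asboolP.
  by apply/asboolP; exact: cc'int (gsG l).
apply: (abP (F c `&` F c')) => [|l]; first exact: convex_setI.
have [zE zx _] := zP _ (okl l); exists (z (c, c', gs l)); split.
- by split; apply: zE; rewrite !inE eqxx ?orbT.
- move=> m ml; apply: Nge0; apply: zE.
  by rewrite !inE gsG andbT (inj_eq gs_inj) ml !orbT.
- by apply: Nlt0; split=> //; exact: sz.
Qed.

Local Close Scope ring_scope.

(** * Piercing *)

Lemma leq_bin_diag (n m j : nat) : ('C(n, m) <= 'C(n + j, m + j))%N.
Proof.
elim: j => [|j IHj]; first by rewrite !addn0.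
by rewrite !addnS (leq_trans IHj)// binS leq_addl.
Qed.

(** This puts the definition of [m0] in the form used by [m0_binomials]: with [l = p - q - k - 1],
    [l * (l + 2 * k + 3) / 2 = (k + 2) * l + 'C(l, 2)]. *)
Lemma m0P (p q k : nat) : (k + q + 1 <= p)%N ->
  (k.+2 * (p - q - k - 1) + 'C(p - q - k - 1, 2) + 1 <= 'C((m0 p q k).+1, 2))%N.
Proof.
move=> kqp; rewrite /m0; case: ex_minnP => m + _; apply: leq_trans.
rewrite /m0_bound leq_add2r; set l := (p - q - k - 1)%N.
have -> : (p - q + k + 2 = l + k.*2 + 3)%N by rewrite /l -addnn; lia.
suff -> : (l * (l + k.*2 + 3) = (k.+2 * l + 'C(l, 2)) * 2)%N by rewrite mulnK.
have := mul_bin_diag l 1; rewrite bin1 -addnn; case: (l) => [|l'] /=; nia.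
Qed.

Lemma pierced_seq (T : choiceType) (I : finType) (F : I -> set T) (n : nat)
    (s : seq T) : (size s <= n)%N ->
  (forall i, exists2 z, z \in s & F i z) ->
  exists S : {fset T}, (#|` S| <= n)%N /\ pierced F [set: I] [set` S].
Proof.
move=> sn sF; exists [fset z in s]%fset; split.
  by rewrite card_fseq (leq_trans (size_undup _)).
by move=> i _; have [z zs Fz] := sF i; exists z; split=> //=; rewrite in_fset.
Qed.

Theorem theorem3 (R : realType) (d p q k r : nat)
    (I : finType) (F : I -> set 'rV[R]_d)
    (hqp : (q <= p)%N) (hdq : (d + 1 <= q)%N)
    (hk : (k + q + 1 <= p)%N)
    (hcard : (p <= #|I|)%N)
    (hne : forall i, F i !=set0)
    (hcompact : forall i, compact (F i))
    (hconvex : forall i, convex_set (F i))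
    (hnondeg : ~ degenerate F (p - q))
    (hpqr : pq_r_property F p q r)
    (hr : (('C(p, q)%:Z - 'C(p - d + 1, q - d + 1)%:Z + 1
            + 'C(q - d + m0 p q k - 2, q - d)%:Z
            + 'C(q - d + m0 p q k - 1, q - d + 1)%:Z)%R <= r%:Z)%R) :
  exists S : {fset 'rV[R]_d},
    (#|` S| <= k + 2)%N /\ pierced F [set: I] [set` S].
Proof.
(* In dimension 0 all members contain the only point, so the family is degenerate. *)
case: d => [|d] in F hdq hne hcompact hconvex hnondeg hpqr hr *.
  case: hnondeg; exists finset.set0; first by rewrite cards0.
  exists 0%R => i _; have [y Fy] := hne i; exists y; split=> //.
  exact: thinmx0.
have {}hr : ('C(p, q) + 1 + 'C(q - d.+1 + m0 p q k - 2, q - d.+1)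
    + 'C(q - d.+1 + m0 p q k - 1, (q - d.+1).+1)
    <= r + 'C((p - d.+1).+1, (q - d.+1).+1))%N.
  by move: hr; rewrite !addn1; lia.
(* ['C(p - d, q - d) <= 'C(p, q)], so [hr] forces [r >= 1]; hence some [q] members intersect. *)
have r0 : (0 < r)%N.
  have := leq_bin_diag (p - d.+1).+1 (q - d.+1).+1 d.
  rewrite (_ : (p - d.+1).+1 + d = p)%N; last by lia.
  by rewrite (_ : (q - d.+1).+1 + d = q)%N; lia.
have [_ hP] := hpqr.
have [G0 G0d G0int] : exists2 G0 : {set I}, #|G0| = d.+1 & intersecting F G0.
  have [|P [_ _ Pp]] := subset_between (n := p) (finset.sub0set [set: I]%SET).
    by rewrite cards0 cardsT.
  have /card_gt0P[Q] := leq_trans r0 (hP P Pp).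
  rewrite inE => /and3P[_ /eqP Qq /asboolP Qint].
  have [|G0 [_ G0Q G0d]] := subset_between (n := d.+1) (finset.sub0set Q).
    by rewrite cards0 Qq; lia.
  by exists G0 => //; exact: intersectingS Qint.
have [G [x [a [b [Gd Gx xG xline]]]]] :=
  line_reduction hcompact hconvex G0d G0int.
pose A := [set c | `[< ~ F c x >]]%SET.
have Ap : (p - q < #|A|)%N.
  rewrite ltnNge; apply/negP => Ap; apply: hnondeg; exists A => //.
  exists x => i; rewrite !inE => /asboolPn; rewrite not_notP => Fix.
  by exists x.
have lineF i s t y : F i (a + s *: b)%R -> F i (a + t *: b)%R ->
    (s <= y)%R -> (y <= t)%R -> F i (a + y *: b)%R.
  move=> Fs Ft sy yt; have [st|st] := eqVneq s t.
    by rewrite (_ : y = s)//; apply/eqP; rewrite eq_le sy st yt.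
  have st0 : (0 < t - s)%R by rewrite subr_gt0 lt_neqAle st (le_trans sy).
  have := convex_set_comb (t := ((t - y) / (t - s))%R) (hconvex i) Fs Ft.
  rewrite divr_ge0 ?subr_ge0 ?(le_trans sy)// ler_pdivrMr// mul1r.
  rewrite lerD2l lerN2 sy => /(_ isT isT).
  set u := (X in F i X -> _); suff -> : u = (a + y *: b)%R by [].
  rewrite /u; apply/rowP => j; rewrite !mxE.
  by field; rewrite lt0r_neq0.
have [[D [DA Dk Dline]]|[s [sk sA]]] :=
    @interval_piercing R _ I F (fun t => a + t *: b)%R k.+1 A hne lineF; last first.
  apply: (@pierced_seq _ _ _ _ (x :: s)); first by rewrite /= addn2.
  move=> i; have [iA|] := boolP (i \in A).
    by have [z zs Fz] := sA i iA; exists z; rewrite // inE zs orbT.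
  rewrite inE => /asboolPn; rewrite not_notP => Fix; exists x => //.
  by rewrite inE eqxx.
have Ax c : c \in A -> ~ F c x by rewrite inE => /asboolP.
(* [D] grows to [p - q + 1] members of [A], then to [B] outside [G] with [#|G :|: B| = p]; this
   leaves at most [q - d - 2] members of [B] outside [A]. *)
have [|B2 [DB2 B2A B2p]] := @subset_between _ D A (p - q).+1 DA.
  by rewrite Dk Ap andbT; lia.
have B2G : B2 \subset ~: G.
  apply: fintype.subset_trans B2A _; apply/fintype.subsetP => c /Ax cx.
  by rewrite inE; apply/negP => /Gx.
have [|B [B2B BG Bp]] := @subset_between _ B2 (~: G)%SET (p - d.+1) B2G.
  by have := cardsC G; rewrite B2p Gd; lia.
have GB : [disjoint G & B]%B by rewrite disjoint_sym finset.disjoints_subset.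
have BA : (#|B :\: A| < q - d.+1)%N.
  apply: leq_ltn_trans (subset_leq_card (finset.setDS B B2A)) _.
  by rewrite cardsDS// B2p Bp; lia.
have G0' : (0 < #|G|)%N by rewrite Gd.
have faceS (Q Q' : {set I}) : Q \subset Q' ->
    `[< intersecting F Q' >] -> `[< intersecting F Q >].
  by move=> QQ' /asboolP Q'int; apply/asboolP; exact: intersectingS Q'int.
have AG c : c \in A -> ~~ `[< intersecting F (c |: G)%SET >].
  by move=> /Ax cx; apply/asboolPn; exact: xG.
have DG : {in D &, forall c c', c != c' ->
    exists2 g, g \in G & ~~ `[< intersecting F (c |: (c' |: G :\ g))%SET >]}.
  move=> c c' cD c'D cc'; apply: contrapT => NG.
  have [|t tP] := xline c c' cc' (Ax c (fintype.subsetP DA c cD))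
      (Ax c' (fintype.subsetP DA c' c'D)).
    move=> g gG; apply: contrapT => gN; apply: NG; exists g => //.
    exact/asboolPn.
  exact: Dline cc' t tP.
have bound := nonfaces_bound faceS G0' GB (fintype.subset_trans DB2 B2B) BA AG DG.
have GBp : #|(G :|: B)%SET| = p.
  by rewrite cardsU disjoint_setI0// cards0 subn0 Gd Bp; lia.
have := hP _ GBp; set faces := #|_| => rfaces.
have {bound rfaces} : (r + 'C((p - d.+1).+1, (q - d.+1).+1) <= 'C(p, q) +
    ('C(p - d.+1 - k.+2, (q - d.+1).+1) +
     k.+2 * 'C(p - d.+1 - k.+2, q - d.+1)))%N.
  move: bound; rewrite Gd Bp Dk (_ : d.+1 + (q - d.+1) = q)%N; last by lia.
  rewrite (_ : d.+1 + (p - d.+1) = p)%N; last by lia.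
  apply: leq_trans; rewrite leq_add2r; apply: (leq_trans rfaces).
  rewrite /faces leq_eqVlt; apply/orP; left; apply/eqP/eq_card => Q.
  by apply/idP/idP; rewrite !inE.
(* Here [a + l] is [p - d.+1 - k.+2], the size of [B :\: D]; the [+ 1] in [hr] then gives the
   contradiction. *)
have := m0_binomials (q - d.+2) (m0P hk).
move: hr hk hdq hqp; clear => hr hk hdq hqp.
rewrite (_ : (q - d.+2).+2 = (q - d.+1).+1)%N; last by lia.
rewrite (_ : (q - d.+2).+1 = (q - d.+1))%N; last by lia.
rewrite (_ : q - d.+2 + (p - q - k - 1) = p - d.+1 - k.+2)%N; last by lia.
rewrite (_ : q - d.+2 + m0 p q k - 1 = q - d.+1 + m0 p q k - 2)%N; last by lia.
rewrite (_ : q - d.+2 + m0 p q k = q - d.+1 + m0 p q k - 1)%N; last by lia.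
by move: hr; lia.
Qed.
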